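(* Let $1<s<\infty$, $0<p\le s$ and $-n\left(1-\frac ps\right)\le\alpha<n(p-1)$. Suppose that a sublinear operator $H$ (acting on functions on $\mathbf{R}^n$) is bounded on $L^s$ and satisfies: (i) there is a constant $C$ such that $|Hf(x)|\le C\|f\|_{L^1}/|x-x_0|^n$ whenever $\operatorname{supp}f\subseteq B(x_0,2^k)$ and $|x-x_0|\ge2^{k+1}$, with $x_0\in\mathbf{R}^n$ and $k\in\mathbf{Z}$; (ii) $|Hf|\le\sum_j|\lambda_j||Ha_j|$ for every $f=\sum_j\lambda_ja_j\in BL^{p,s}_{|x|^\alpha}$, where each $a_j$ is a $(p,s,\alpha)$-block and $\sum_j|\lambda_j|^{\bar p}<\infty$. Then $H$ is of type $(BL^{p,s}_{|x|^\alpha},BL^{p,s}_{|x|^\alpha})$; that is, there is a constant $C'$ such that $\|Hf\|_{BL^{p,s}_{|x|^\alpha}}\le C'\|f\|_{BL^{p,s}_{|x|^\alpha}}$ for all $f\in BL^{p,s}_{|x|^\alpha}$.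
   Context: $H$ is assumed to be defined, with values in measurable functions, on $L^s(\mathbf{R}^n)$ and on $BL^{p,s}_{|x|^\alpha}$; sublinear means $|H(f+g)|\le|Hf|+|Hg|$ and $|H(cf)|=|c||Hf|$. Condition (i) concerns functions $f$ in the domain of $H$. $B(x_0,r)=\{x\in\mathbf{R}^n:|x-x_0|\le r\}$ and $|\cdot|$ is Lebesgue measure for sets. Blocks: for $\alpha\in\mathbf{R}$, $0<p<\infty$, $0<s\le\infty$, a function $a$ on $\mathbf{R}^n$ is a $(p,s,\alpha)$-block if there is a ball $B(x_0,r)$ with $x_0\in\mathbf{R}^n$, $r>0$, such that $\operatorname{supp}a\subseteq B(x_0,r)$ and $\|a\|_{L^s}\le|B(x_0,r)|^{-\frac{\alpha}{pn}-\frac1p+\frac1s}$. Let $\bar p=\min\{p,1\}$. The space $BL^{p,s}_{|x|^\alpha}$ consists of all $f=\sum_{k}\lambda_ka_k$ (countable sum, convergence a.e.), where each $a_k$ is a $(p,s,\alpha)$-block and $\sum_k|\lambda_k|^{\bar p}<\infty$, with quasinorm $\|f\|_{BL^{p,s}_{|x|^\alpha}}=\inf\left(\sum_k|\lambda_k|^{\bar p}\right)^{1/\bar p}$, the infimum over all such decompositions. *)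

(* Defs.v *)
From HB Require Import structures.
From mathcomp Require Import all_boot all_order all_algebra.
From mathcomp Require Import complex.
From mathcomp Require Import all_classical all_reals all_analysis.

Set Implicit Arguments.
Unset Strict Implicit.
Unset Printing Implicit Defensive.

Import Order.TTheory GRing.Theory Num.Theory.
Import numFieldNormedType.Exports.

Local Open Scope classical_set_scope.
Local Open Scope ring_scope.

Section tuple_measure.
Context d (T : measurableType d) (R : realType).
Variable m : {sigma_finite_measure set T -> \bar R}.

Section step.
Context (n : nat) (mu : {sigma_finite_measure set (n.-tuple T) -> \bar R}).

Definition tuple_cons (tx : T * n.-tuple T) : n.+1.-tuple T :=
  [tuple of tx.1 :: tx.2].

Let tuple_uncons (x : n.+1.-tuple T) : T * n.-tuple T :=
  (thead x, [tuple of behead x]).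

Let tuple_consK : cancel tuple_cons tuple_uncons.
Proof. by move=> [t x]; congr pair; apply/val_inj. Qed.

Lemma measurable_tuple_cons : measurable_fun setT tuple_cons.
Proof. exact: measurable_cons. Qed.

Let measurable_tuple_uncons : measurable_fun setT tuple_uncons.
Proof.
apply: measurable_fun_pair; last exact: measurable_behead.
exact: (measurable_tnth ord0).
Qed.

Definition tuple_measureS : set (n.+1.-tuple T) -> \bar R :=
  pushforward (m \x mu)%E tuple_cons.

Let tuple_measureS0 : tuple_measureS set0 = 0%E.
Proof. by rewrite /tuple_measureS /pushforward preimage_set0 measure0. Qed.

Let tuple_measureS_ge0 A : (0 <= tuple_measureS A)%E.
Proof. by rewrite /tuple_measureS /pushforward; exact: measure_ge0. Qed.

Let tuple_measureS_sigma_additive : semi_sigma_additive tuple_measureS.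
Proof.
have preim A : measurable A -> measurable (tuple_cons @^-1` A).
  by move=> mA; rewrite -[X in measurable X]setTI; exact: measurable_tuple_cons.
move=> F mF tF mUF; rewrite /tuple_measureS /pushforward preimage_bigcup.
apply: measure_semi_sigma_additive.
- by move=> i; exact: preim.
- apply/trivIsetP => i j _ _ ij; rewrite -preimage_setI.
  by move/trivIsetP : tF => -> //; rewrite preimage_set0.
- by rewrite -preimage_bigcup; exact: preim.
Qed.

HB.instance Definition _ := isMeasure.Build _ _ _ tuple_measureS
  tuple_measureS0 tuple_measureS_ge0 tuple_measureS_sigma_additive.

Let tuple_measureS_sigma_finite : sigma_finite setT tuple_measureS.
Proof.
have /sigma_finiteP[F [TF ndF Foo]] := sigma_finiteT m.
have /sigma_finiteP[G [TG ndG Goo]] := sigma_finiteT mu.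
exists (fun i => tuple_uncons @^-1` (F i `*` G i)).
  rewrite -preimage_bigcup -(preimage_setT tuple_uncons); congr (_ @^-1` _).
  apply/seteqP; split=> // -[t x] _.
  have [i _ Fit] : (\bigcup_i F i) t by rewrite -TF.
  have [j _ Gjx] : (\bigcup_i G i) x by rewrite -TG.
  exists (maxn i j) => //; split.
    by move: (t) Fit; exact/subsetPset/ndF/leq_maxl.
  by move: (x) Gjx; exact/subsetPset/ndG/leq_maxr.
move=> i; have [mFi Fi] := Foo i; have [mGi Gi] := Goo i; split.
  rewrite -[X in measurable X]setTI; apply: measurable_tuple_uncons => //.
  exact: measurableX.
rewrite /tuple_measureS /pushforward (_ : _ @^-1` _ = F i `*` G i).
  by rewrite product_measure1E// lte_mul_pinfty// ge0_fin_numE.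
by apply/funext => x; exact: (congr1 (F i `*` G i) (tuple_consK x)).
Qed.

HB.instance Definition _ :=
  @Measure_isSigmaFinite.Build _ _ _ tuple_measureS tuple_measureS_sigma_finite.

End step.

(* the product of n copies of m, a measure on T^n *)
Fixpoint tuple_measure (n : nat) :
    {sigma_finite_measure set (n.-tuple T) -> \bar R} :=
  match n with
  | 0 => dirac [tuple]
  | k.+1 => tuple_measureS (tuple_measure k)
  end.

Lemma tuple_measure_box (n : nat) (A : 'I_n -> set T) :
  (forall i, measurable (A i)) ->
  tuple_measure n [set x | forall i, A i (tnth x i)] =
  (\prod_(i < n) m (A i))%E.
Proof.
elim: n A => [A mA|n IH A mA].
  by rewrite big_ord0 [LHS]diracE mem_set//; case.
rewrite big_ord_recl -(IH (A \o lift ord0)); last by move=> i; exact: mA.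
have mbox :
    measurable [set x : n.-tuple T | forall i, A (lift ord0 i) (tnth x i)].
  rewrite (_ : [set _ | _] = \bigcap_(i in [set: 'I_n])
      ((fun x : n.-tuple T => tnth x i) @^-1` A (lift ord0 i))).
    apply: fin_bigcap_measurable; first exact: finite_finset.
    move=> i _; rewrite -[X in measurable X]setTI.
    exact: measurable_tnth.
  by apply/seteqP; split=> x /= Ax i; [move=> _|]; apply: Ax.
rewrite -(product_measure1E _ _ (mA ord0) mbox) /= /tuple_measureS /pushforward.
congr (_ _); apply/seteqP; split=> -[t x] /=.
  move=> Ax; split; first exact: (Ax ord0).
  by move=> i; have := Ax (lift ord0 i); rewrite tnthS.
by move=> [At Ax] i; have [j ->|->//] := unliftP ord0 i; rewrite tnthS.
Qed.

End tuple_measure.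

(* R^n, with its Borel sigma-algebra; [measurableTypeR R] is R itself, with the
   sigma-algebra on which the library defines [lebesgue_measure].  Borel
   functions represent all classes, modulo a.e. equality, of Lebesgue
   measurable functions. *)
Notation Rn R n := (n.-tuple (measurableTypeR R)).

Section Euclidean_space.
Context {R : realType} {n : nat}.

Definition lebesgue_Rn : {sigma_finite_measure set (Rn R n) -> \bar R} :=
  tuple_measure (@lebesgue_measure R) n.

Definition eucl_dist (x y : Rn R n) : R :=
  Num.sqrt (\sum_(i < n) ((tnth x i : R) - tnth y i) ^+ 2).

Definition cball (x0 : Rn R n) (r : R) : set (Rn R n) :=
  [set x | eucl_dist x x0 <= r].

End Euclidean_space.

(* Functions on R^n may be real- or complex-valued: everything below is
   parametrized by the field of scalars. *)
Variant scalar_kind := real_scalars | complex_scalars.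

Definition scalar_field (R : realType) (k : scalar_kind) : numFieldType :=
  match k with real_scalars => R | complex_scalars => R[i]%C end.

(* the absolute value as an element of R; the norm of [R[i]] has values in
   [R[i]] *)
Definition modulus (R : realType) (k : scalar_kind) : scalar_field R k -> R :=
  match k with
  | real_scalars => fun x : R => `|x|
  | complex_scalars => fun z : R[i]%C => complex.Re `|z|
  end.

Section block_spaces.
Context {R : realType} {n : nat} {k : scalar_kind}.
Implicit Types (f g : Rn R n -> scalar_field R k) (p alpha : R) (s : \bar R).

Definition measurable_scalar_fun f : Prop :=
  match k return (Rn R n -> scalar_field R k) -> Prop with
  | real_scalars => fun f : Rn R n -> R => measurable_fun setT f
  | complex_scalars => fun f : Rn R n -> R[i]%C =>
      measurable_fun setT (fun x => complex.Re (f x)) /\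
      measurable_fun setT (fun x => complex.Im (f x))
  end f.

Definition normL s f : \bar R :=
  Lnorm (@lebesgue_Rn R n) s (fun x => (modulus (f x))%:E).

Definition inL s f : Prop := measurable_scalar_fun f /\ (normL s f < +oo)%E.

(* Functions are identified when they agree almost everywhere, so the support
   of a function is contained in B when the function vanishes almost everywhere
   outside B. *)
Definition supported f (B : set (Rn R n)) : Prop :=
  {ae @lebesgue_Rn R n, forall x, ~ B x -> f x = 0}.

Definition block p s alpha (a : Rn R n -> scalar_field R k) : Prop :=
  measurable_scalar_fun a /\
  exists (x0 : Rn R n) (r : R),
    [/\ 0 < r,
        supported a (cball x0 r) &
        (normL s a <= lebesgue_Rn (cball x0 r) `^
           (- (alpha / (p * n%:R)) - p^-1 + fine s^-1)%R)%E].

Definition block_sum p (lambda : nat -> scalar_field R k) : \bar R :=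
  (\sum_(0 <= j <oo) (modulus (lambda j) `^ Num.min p 1)%:E)%E.

(* f = sum_j lambda_j a_j is a decomposition of f into blocks; finite sums are
   the case where lambda_j = 0 for almost all j. *)
Definition block_decomposition p s alpha (lambda : nat -> scalar_field R k)
    (a : nat -> Rn R n -> scalar_field R k) f : Prop :=
  [/\ forall j, block p s alpha (a j),
      (block_sum p lambda < +oo)%E &
      {ae @lebesgue_Rn R n, forall x,
        series (fun j => lambda j * a j x) @ \oo --> f x}].

Definition inBL p s alpha f : Prop :=
  measurable_scalar_fun f /\
  exists lambda a, block_decomposition p s alpha lambda a f.

(* equal to +oo when f has no decomposition into blocks *)
Definition normBL p s alpha f : \bar R :=
  ereal_inf [set y | exists lambda a,
    block_decomposition p s alpha lambda a f /\
    y = (block_sum p lambda `^ ((Num.min p 1)^-1)%R)%E].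

(* The operators are defined on all functions, but only their restrictions to
   a given domain matter. *)
Definition sublinear_on (D : set (Rn R n -> scalar_field R k))
    (H : (Rn R n -> scalar_field R k) -> (Rn R n -> scalar_field R k)) : Prop :=
  (forall f g, D f -> D g -> D (fun x => f x + g x) ->
    {ae @lebesgue_Rn R n, forall x,
      modulus (H (fun y => f y + g y) x) <=
      modulus (H f x) + modulus (H g x)}) /\
  (forall (c : scalar_field R k) f, D f -> D (fun x => c * f x) ->
    {ae @lebesgue_Rn R n, forall x,
      modulus (H (fun y => c * f y) x) = modulus c * modulus (H f x)}).

Definition bounded_on_L s
    (H : (Rn R n -> scalar_field R k) -> (Rn R n -> scalar_field R k)) : Prop :=
  exists C : R, forall f, inL s f -> (normL s (H f) <= C%:E * normL s f)%E.

End block_spaces.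

(* Main.v *)
Require Import Defs.
From mathcomp Require Import all_boot all_order all_algebra.
From mathcomp Require Import complex ring lra.
From mathcomp Require Import all_classical all_reals all_analysis.
From mathcomp Require Import measurable_realfun.

Set Implicit Arguments.
Unset Strict Implicit.
Unset Printing Implicit Defensive.

Import Order.TTheory GRing.Theory Num.Theory.
Import numFieldNormedType.Exports.

Local Open Scope classical_set_scope.
Local Open Scope ring_scope.

(** Why the theorem holds.  Write e = - alpha / (p n) - 1/p + 1/s for the exponent
    in the size condition of a block.  The two bounds on alpha say exactly that
    1/s - 1 < e <= 0.

    The image of a block a, carried by a ball of radius about 2^k, is a molecule.
    Cut it along the dyadic balls of radius 2^(k+i+1) with the same centre.  On
    the innermost ball the L^s bound applies; since e <= 0 and balls of comparable
    radii have comparable measures, this piece is a multiple of a block.  On the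
    i-th annulus the pointwise decay and the Hoelder inequality applied to a give a
    piece which is C 2^(- i n delta) times a block, where
    delta = 1 - 1/s + e > 0.  Only the crude measure ratio 2^(- i) between
    successive balls is used below, so the coefficients are M q^i with
    q = 2^(- delta) < 1; they do not depend on a ([molecule_decomposition]).

    If f is the sum of the lambda_j a_j, then |Hf| is at most the sum of the
    |lambda_j| |H a_j|, hence at most the sum over pairs (j, i) of
    |lambda_j| M q^i times nonnegative blocks, and the sum of the pbar-th powers
    of these coefficients is that of the |lambda_j| times a constant.  It remains
    to pass from a domination to a decomposition.  If |h| <= G, where G is the sum
    of the c_m g_m, then h is the sum of the c_m (h / G) g_m, and (h / G) g_m is a
    block because |h / G| <= 1 ([dominated_block_decomposition]).  This requires G
    to be finite almost everywhere: on a set of finite measure the blocks are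
    bounded in L^1, those on small balls because e + 1 - 1/s > 0 and those on
    large balls because e <= 0 ([real_block_locally_integrable]), and the c_m are
    summable because pbar <= 1. *)

(** * Measure of Euclidean balls *)

Section balls.
Context {R : realType} {n : nat}.
Implicit Types (x y : Rn R n) (r : R).

Lemma tnth_sub_le_eucl_dist x y (i : 'I_n) :
  `|(tnth x i : R) - tnth y i| <= eucl_dist x y.
Proof.
rewrite -sqrtr_sqr; apply: ler_wsqrtr.
by rewrite (bigD1 i)//= lerDl sumr_ge0// => j _; exact: sqr_ge0.
Qed.

Lemma eucl_dist_le x y r : 0 <= r ->
  (forall i : 'I_n, `|(tnth x i : R) - tnth y i| <= r / n%:R) ->
  eucl_dist x y <= r.
Proof.
move=> r0 xy; rewrite -[leRHS](ger0_norm r0) -sqrtr_sqr; apply: ler_wsqrtr.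
have [n0|n0] := posnP n.
  rewrite big1 ?sqr_ge0// => -[i ilt] _.
  by exfalso; move: ilt; rewrite n0.
have n0' : 0 < n%:R :> R by rewrite ltr0n.
apply: (@le_trans _ _ (\sum_(i < n) (r / n%:R) ^+ 2)).
  apply: ler_sum => i _; rewrite -real_normK ?num_real//.
  by rewrite ler_sqr ?nnegrE// divr_ge0// ltW.
rewrite sumr_const card_ord -[leLHS]mulr_natl.
rewrite (_ : n%:R * (r / n%:R) ^+ 2 = r ^+ 2 / n%:R); last by field; rewrite gt_eqF.
by rewrite ler_pdivrMr// ler_peMr ?sqr_ge0// ler1n.
Qed.

Lemma measurable_eucl_dist y :
  measurable_fun [set: Rn R n] (fun x => eucl_dist x y : R).
Proof.
apply: (measurableT_comp (f := @Num.sqrt R)).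
  by apply: continuous_measurable_fun; exact: sqrt_continuous.
apply: measurable_sum => i; apply: measurable_funX.
apply: measurable_funB => //; exact: (measurable_tnth i).
Qed.

Lemma measurable_cball y r : measurable (cball y r).
Proof.
rewrite -[X in measurable X]setTI (_ : cball y r =
  (fun x => eucl_dist x y) @^-1` [set` `]-oo, r]%R]).
  exact: measurable_eucl_dist.
by apply/seteqP; split=> x; rewrite /= /cball /= in_itv.
Qed.

(* The measure of a box is a product of lengths.  The ball of radius r lies in the
   cube of half-side r and contains the cube of half-side r / n. *)
Let cube y r : set (Rn R n) :=
  [set x | forall i,
    [set` `[(tnth y i : R) - r, (tnth y i : R) + r]%R] (tnth x i)].

Let measurable_cube y r : measurable (cube y r).
Proof.
rewrite (_ : cube y r = \bigcap_(i in [set: 'I_n])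
   ((fun x : Rn R n => tnth x i) @^-1`
     [set` `[(tnth y i : R) - r, (tnth y i : R) + r]%R])).
  apply: fin_bigcap_measurable; first exact: finite_finset.
  move=> i _; rewrite -[X in measurable X]setTI.
  exact: measurable_tnth.
by apply/seteqP; split=> x /= Ax i; [move=> _|]; apply: Ax.
Qed.

Let measure_cube y r : 0 < r -> lebesgue_Rn (cube y r) = ((2 * r) ^+ n)%:E.
Proof.
move=> r0; have := @tuple_measure_box _ _ _ (@lebesgue_measure R) n
  (fun i => [set` `[(tnth y i : R) - r, (tnth y i : R) + r]%R])
  (fun i => measurable_itv _).
rewrite /lebesgue_Rn /cube => ->.
rewrite (eq_bigr (fun=> (2 * r)%:E)); last first.
  move=> i _; apply: (etrans (lebesgue_measure_itv _)).
  rewrite /= lte_fin ifT; last by lra.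
  by rewrite -EFinB; congr EFin; ring.
by rewrite prodEFin prodr_const card_ord.
Qed.

Lemma measure_cball_le y r : 0 < r ->
  (lebesgue_Rn (cball y r) <= ((2 * r) ^+ n)%:E)%E.
Proof.
move=> r0; rewrite -(measure_cube y r0); apply: le_measure;
  rewrite ?inE//; first exact: measurable_cball.
move=> x xy i; rewrite /= in_itv/=.
have := le_trans (tnth_sub_le_eucl_dist x y i) xy.
by rewrite ler_distl.
Qed.

Lemma measure_cball_ge y r : (0 < n)%N -> 0 < r ->
  (((2 * (r / n%:R)) ^+ n)%:E <= lebesgue_Rn (cball y r))%E.
Proof.
move=> n0 r0; rewrite -(measure_cube y); last by rewrite divr_gt0// ltr0n.
apply: le_measure; rewrite ?inE//; first exact: measurable_cball.
move=> x xy; apply: eucl_dist_le; first exact: ltW.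
by move=> i; have := xy i; rewrite /= in_itv/= ler_distl.
Qed.

(** Two-sided comparison with r^n; with the dimension fixed it stands in for the
    exact scaling law of the measure. *)
Lemma measure_cballE y r : (0 < n)%N -> 0 < r -> exists V : R,
  [/\ 0 < V, lebesgue_Rn (cball y r) = V%:E,
      (2 * (r / n%:R)) ^+ n <= V & V <= (2 * r) ^+ n].
Proof.
move=> n0 r0; have n0' : 0 < n%:R :> R by rewrite ltr0n.
have lb := measure_cball_ge y n0 r0; have ub := measure_cball_le y r0.
have fin : lebesgue_Rn (cball y r) \is a fin_num.
  by rewrite ge0_fin_numE// (le_lt_trans ub)// ltry.
exists (fine (lebesgue_Rn (cball y r))); rewrite fineK// -!lee_fin -lte_fin fineK//.
split => //; rewrite (lt_le_trans _ lb)// lte_fin exprn_gt0//.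
by rewrite mulr_gt0// divr_gt0.
Qed.

End balls.

(** * Lebesgue norms and almost everywhere finite series *)

Lemma le_poweR (R : realType) (x y : \bar R) (r : R) : 0 <= r ->
  (0 <= x)%E -> (x <= y)%E -> (x `^ r <= y `^ r)%E.
Proof.
move=> r0 x0 xy; apply: gt0_ler_poweR => //; rewrite in_itv/= leey andbT//.
exact: le_trans xy.
Qed.

Section Lnorm_complements.
Context d (T : measurableType d) (R : realType) (mu : {measure set T -> \bar R}).
Local Open Scope ereal_scope.
Implicit Types (f g : T -> R) (s : R) (A : set T).

Let measurable_norm_powR f s : measurable_fun setT f ->
  measurable_fun setT (fun x => (`|f x| `^ s)%:E).
Proof.
move=> mf; apply/measurable_EFinP.
apply: (measurableT_comp (measurable_powR s)).
exact: measurableT_comp.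
Qed.

Lemma ae_le_Lnorm f g s : (0 < s)%R ->
  measurable_fun setT f -> measurable_fun setT g ->
  {ae mu, forall x, (`|f x| <= `|g x|)%R} ->
  Lnorm mu s%:E (EFin \o f) <= Lnorm mu s%:E (EFin \o g).
Proof.
move=> s0 mf mg fg; rewrite unlock.
apply: le_poweR; first by rewrite invr_ge0 ltW.
  by apply: integral_ge0 => x _; exact: poweR_ge0.
apply: ae_ge0_le_integral => //=; [exact: measurable_norm_powR..|].
by apply: filterS fg => x fgx _; rewrite lee_fin ge0_ler_powR// ltW.
Qed.

Lemma LnormZ f s (c : R) : (0 < s)%R -> (0 <= c)%R -> measurable_fun setT f ->
  Lnorm mu s%:E (EFin \o (fun x => c * f x)%R) =
  c%:E * Lnorm mu s%:E (EFin \o f).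
Proof.
move=> s0 c0 mf; rewrite unlock.
under eq_integral => x _.
  rewrite /= normrM (ger0_norm c0) powRM ?normr_ge0// EFinM.
  over.
rewrite ge0_integralZl_EFin//=.
- rewrite poweRM ?lee_fin ?powR_ge0//.
    by rewrite poweR_EFin -powRrM divff ?gt_eqF// powRr1.
  by apply: integral_ge0 => x _; rewrite lee_fin powR_ge0.
- exact: measurable_norm_powR.
- exact: powR_ge0.
Qed.

Lemma Lnorm_indic A s : (0 < s)%R -> measurable A ->
  Lnorm mu s%:E (EFin \o \1_A) = mu A `^ s^-1.
Proof.
move=> s0 mA; rewrite unlock; congr (_ `^ _).
rewrite -[in RHS](setIT A) -integral_indic//; apply: eq_integral => x _ /=.
rewrite indicE; case: (x \in A); first by rewrite normr1 powR1.
by rewrite normr0 powR0// gt_eqF.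
Qed.

(** The Hoelder inequality against the indicator of A. *)
Lemma Lnorm1_restrict_le f s A : (1 < s)%R ->
  measurable_fun setT f -> measurable A ->
  Lnorm mu 1 (EFin \o (f \* \1_A)%R) <=
  Lnorm mu s%:E (EFin \o f) * mu A `^ (1 - s^-1)%R.
Proof.
move=> s1 mf mA; have s0 : (0 < s)%R by lra.
have q0 : (0 < (1 - s^-1)^-1)%R by rewrite invr_gt0 subr_gt0 invf_lt1.
have := @hoelder _ _ _ mu f \1_A s ((1 - s^-1)^-1)%R mf _ s0 q0.
rewrite Lnorm_indic// invrK; apply; first exact: measurable_indic.
by rewrite addrC subrK.
Qed.

Lemma integral_Lnorm1_restrict f A : measurable A -> (forall x, (0 <= f x)%R) ->
  \int[mu]_(x in A) (f x)%:E = Lnorm mu 1 (EFin \o (f \* \1_A)%R).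
Proof.
move=> mA f0; rewrite integral_mkcond Lnorm1; apply: eq_integral => x _.
rewrite patchE /= indicE; case: (x \in A); last by rewrite mulr0 normr0.
by rewrite mulr1 ger0_norm.
Qed.

End Lnorm_complements.

Section ae_finite_series.
Context d (T : measurableType d) (R : realType).
Variable mu : {sigma_finite_measure set T -> \bar R}.
Local Open Scope ereal_scope.

(** On a set of finite measure the sum is integrable by monotone convergence, and
    countably many such sets cover the space. *)
Lemma ae_nneseries_lty (c : R^nat) (g : nat -> T -> R) :
  (forall m, (0 <= c m)%R) -> (forall m x, (0 <= g m x)%R) ->
  (forall m, measurable_fun setT (g m)) ->
  \sum_(0 <= m <oo) (c m)%:E < +oo ->
  (forall A, measurable A -> mu A < +oo -> exists C : R,
    forall m, \int[mu]_(x in A) (g m x)%:E <= C%:E) ->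
  {ae mu, forall x, \sum_(0 <= m <oo) (c m * g m x)%:E < +oo}.
Proof.
move=> c0 g0 mg sumc locg.
have [F FT Ffin] := sigma_finiteT mu.
suff aeF k : {ae mu, forall x, F k x -> \sum_(0 <= m <oo) (c m * g m x)%:E < +oo}.
  apply: filterS (ae_foralln aeF) => x xF.
  have [k _ Fkx] : (\bigcup_k F k) x by rewrite -FT.
  exact: xF Fkx.
have [mF muF] := Ffin k; have [C intC] := locg _ mF muF.
have mG m : measurable_fun setT (fun x => (c m * g m x)%:E).
  by apply/measurable_EFinP/measurable_funM.
have G0 m x : 0 <= (c m * g m x)%:E by rewrite lee_fin mulr_ge0.
have mS : measurable_fun setT (fun x => \sum_(0 <= m <oo) (c m * g m x)%:E).
  by apply: ge0_emeasurable_sum => //.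
suff iS : mu.-integrable (F k) (fun x => \sum_(0 <= m <oo) (c m * g m x)%:E).
  apply: filterS (integrable_ae mF iS) => x xF Fx.
  by have := xF Fx; rewrite ge0_fin_numE//; exact: nneseries_ge0.
apply/integrableP; split; first exact: measurable_funTS.
under eq_integral => x _.
  rewrite gee0_abs; last exact: nneseries_ge0.
  over.
rewrite integral_nneseries//; last by move=> m; exact: measurable_funTS.
have C0 : (0 <= C)%R.
  rewrite -lee_fin (le_trans _ (intC 0%N))//.
  by apply: integral_ge0 => x _; rewrite lee_fin.
apply: (@le_lt_trans _ _ (\sum_(0 <= m <oo) C%:E * (c m)%:E)).
  apply: lee_nneseries => m _; first by rewrite integral_ge0.
  under eq_integral do rewrite EFinM.
  rewrite ge0_integralZl_EFin//.
  - by rewrite muleC lee_wpmul2r// lee_fin.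
  - by move=> x _; rewrite lee_fin.
  - by apply/measurable_EFinP/measurable_funTS.
rewrite nneseriesZl; last by move=> m _; rewrite lee_fin.
by apply: lte_mul_pinfty.
Qed.

End ae_finite_series.

(** * Series of nonnegative terms *)

Section series.
Context {R : realType}.

Lemma nneseries_ge_term (a : (\bar R)^nat) (i : nat) :
  (forall j, (0 <= a j)%E) -> (a i <= \sum_(0 <= j <oo) a j)%E.
Proof.
move=> a0; rewrite (nneseriesD1 (n := i))// leeDl//.
exact: nneseries_ge0.
Qed.

Lemma nneseries_pair (phi : nat -> nat * nat) (a : nat -> nat -> \bar R) :
  set_bij [set: nat] [set: nat * nat] phi -> (forall j i, (0 <= a j i)%E) ->
  (\sum_(0 <= m <oo) a (phi m).1 (phi m).2 =
   \sum_(0 <= j <oo) \sum_(0 <= i <oo) a j i)%E.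
Proof.
move=> phi_bij a0; rewrite nneseries_esumT//.
rewrite -(@reindex_esum R _ _ _ _ phi (fun k => a k.1 k.2) phi_bij).
rewrite nneseries_esumT; last by move=> j; exact: nneseries_ge0.
under [RHS]eq_esum do rewrite nneseries_esumT//.
rewrite esum_esum//; congr (esum _ _).
by apply/seteqP; split.
Qed.

(** The pbar-th powers of the coefficients M q^i of a molecule are summable. *)
Lemma nneseries_geometric_lty (M q r : R) : 0 < M -> 0 < q -> q < 1 -> 0 < r ->
  (\sum_(0 <= i <oo) ((M * q ^+ i) `^ r)%:E < +oo)%E.
Proof.
move=> M0 q0 q1 r0; set z := q `^ r.
have z0 : 0 < z by rewrite powR_gt0.
have z1 : `|z| < 1.
  rewrite gtr0_norm// [ltRHS](_ : 1 = 1 `^ r); last by rewrite powR1.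
  by apply: gt0_ltr_powR => //; rewrite ?nnegrE// ltW.
have termE i : (M * q ^+ i) `^ r = geometric (M `^ r) z i.
  rewrite /geometric/= powRM ?exprn_ge0 ?(ltW M0) ?(ltW q0)//.
  by rewrite -(@powR_mulrn R q) ?(ltW q0)// powRAC powR_mulrn// powR_ge0.
suff : \sum_(0 <= i < N) ((M * q ^+ i) `^ r)%:E @[N --> \oo] -->
    (M `^ r * (1 - z)^-1)%:E by move=> /cvg_lim ->//; rewrite ltry.
apply: cvg_EFin; first by apply: nearW => N; rewrite sumEFin.
apply: (cvg_trans _ (@cvg_geometric_series R (M `^ r) z z1)).
apply: near_eq_cvg; apply: nearW => N; rewrite /comp sumEFin/=.
by apply: eq_bigr => i _; rewrite termE.
Qed.

(** An l^r sequence with r <= 1 is bounded, so c_m = c_m^(1-r) c_m^r is at most a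
    constant times c_m^r. *)
Lemma nneseries_powR_lty (c : R^nat) (r : R) : 0 < r -> r <= 1 ->
  (forall m, 0 <= c m) ->
  (\sum_(0 <= m <oo) (c m `^ r)%:E < +oo)%E ->
  (\sum_(0 <= m <oo) (c m)%:E < +oo)%E.
Proof.
move=> r0 r1 c0 sumc; set S := (\sum_(0 <= m <oo) (c m `^ r)%:E)%E in sumc.
have cr0 m : (0 <= (c m `^ r)%:E)%E by rewrite lee_fin powR_ge0.
have S0 : (0 <= S)%E by exact: nneseries_ge0.
have SE : S = (fine S)%:E by rewrite fineK// ge0_fin_numE.
pose M := (fine S `^ r^-1) `^ (1 - r).
apply: (@le_lt_trans _ _ (\sum_(0 <= m <oo) (M%:E * (c m `^ r)%:E))%E); last first.
  rewrite nneseriesZl//; apply: lte_mul_pinfty => //.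
  by rewrite lee_fin powR_ge0.
apply: lee_nneseries => m _; first by rewrite lee_fin.
rewrite -EFinM lee_fin.
have [->|cm0] := eqVneq (c m) 0; first by rewrite mulr_ge0 ?powR_ge0.
have cm_gt0 : 0 < c m by rewrite lt_neqAle eq_sym cm0 c0.
rewrite -[leLHS](powRr1 (c0 m)) -{1}(subrK r 1) powRD; last first.
  by rewrite (gt_eqF cm_gt0) implybT.
apply: ler_wpM2r; first exact: powR_ge0.
apply: ge0_ler_powR; rewrite ?nnegrE ?powR_ge0 ?subr_ge0//.
rewrite -[leLHS](powRr1 (c0 m)) -(divff (lt0r_neq0 r0)) powRrM.
apply: ge0_ler_powR; rewrite ?nnegrE ?powR_ge0 ?invr_ge0 ?(ltW r0)//.
  by rewrite fine_ge0.
rewrite -lee_fin -SE.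
exact: (@nneseries_ge_term (fun m => (c m `^ r)%:E)).
Qed.

End series.

(** * Real and complex scalars *)

Section scalars.
Context {R : realType} {K : scalar_kind}.
Implicit Types (z w : scalar_field R K) (r : R).

Definition scalar_of_real : R -> scalar_field R K :=
  match K return R -> scalar_field R K with
  | real_scalars => id
  | complex_scalars => fun r => r%:C%C
  end.

Lemma scalar_of_realD : {morph scalar_of_real : r1 r2 / r1 + r2}.
Proof. by rewrite /scalar_of_real; case: (K) => // r1 r2; rewrite rmorphD. Qed.

Lemma scalar_of_realM : {morph scalar_of_real : r1 r2 / r1 * r2}.
Proof. by rewrite /scalar_of_real; case: (K) => // r1 r2; rewrite rmorphM. Qed.

Lemma scalar_of_real0 : scalar_of_real 0 = 0.
Proof. by rewrite /scalar_of_real; case: (K). Qed.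

Lemma scalar_of_real1 : scalar_of_real 1 = 1.
Proof. by rewrite /scalar_of_real; case: (K). Qed.

Lemma ltr_scalar_of_real r1 r2 :
  (scalar_of_real r1 < scalar_of_real r2) = (r1 < r2).
Proof. by rewrite /scalar_of_real; case: (K) => //=; rewrite ltcR. Qed.

Lemma normr_modulus z : `|z| = scalar_of_real (modulus z).
Proof.
by rewrite /scalar_of_real /modulus; move: z; case: (K).
Qed.

Lemma scalar_of_real_inj : injective scalar_of_real.
Proof. by rewrite /scalar_of_real; case: (K) => // r1 r2 /= [] ->. Qed.

Lemma modulus_ge0 z : 0 <= modulus z.
Proof.
have := normr_ge0 z; rewrite normr_modulus -scalar_of_real0 !le_eqVlt.
rewrite ltr_scalar_of_real => /orP[/eqP/scalar_of_real_inj <-|->].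
  by rewrite eqxx.
by rewrite orbT.
Qed.

Lemma modulusM z w : modulus (z * w) = modulus z * modulus w.
Proof.
by apply: scalar_of_real_inj; rewrite scalar_of_realM -!normr_modulus normrM.
Qed.

Lemma modulus_scalar_of_real r : modulus (scalar_of_real r) = `|r|.
Proof.
rewrite /scalar_of_real /modulus; case: (K) => //=.
by rewrite expr0n/= addr0 sqrtr_sqr.
Qed.

Lemma modulus_eq0 z : modulus z = 0 -> z = 0.
Proof.
by move=> z0; apply/eqP; rewrite -normr_eq0 normr_modulus z0 scalar_of_real0.
Qed.

Lemma modulus0 : modulus (0 : scalar_field R K) = 0.
Proof. by apply: scalar_of_real_inj; rewrite -normr_modulus normr0 scalar_of_real0. Qed.

Lemma scalar_of_real_cvg (u : R^nat) r : u @ \oo --> r ->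
  (fun m => scalar_of_real (u m)) @ \oo --> scalar_of_real r.
Proof.
move=> ur; apply/cvgrPdist_lt => e e0.
have eE : e = scalar_of_real (modulus e) by rewrite -normr_modulus gtr0_norm.
have /cvgrPdist_lt/(_ (modulus e)) := ur.
rewrite -ltr_scalar_of_real scalar_of_real0 -eE => /(_ e0).
apply: filterS => m; rewrite -ltr_scalar_of_real -eE; apply: le_lt_trans.
have -> : scalar_of_real r - scalar_of_real (u m) = scalar_of_real (r - u m).
  by apply/eqP; rewrite subr_eq -scalar_of_realD subrK.
by rewrite normr_modulus modulus_scalar_of_real.
Qed.

Context {n : nat}.
Implicit Types (f : Rn R n -> scalar_field R K) (g : Rn R n -> R).

Lemma measurable_modulus f : measurable_scalar_fun f ->
  measurable_fun setT (fun x => modulus (f x)).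
Proof.
rewrite /modulus /measurable_scalar_fun; move: f; case: (K) => /= f.
  by move=> mf; exact: measurableT_comp.
move=> [mRe mIm].
rewrite (_ : (fun _ => _) = @Num.sqrt R \o
  (fun x => complex.Re (f x) ^+ 2 + complex.Im (f x) ^+ 2)); last first.
  by apply/funext => x /=; case: (f x).
apply: (measurableT_comp (f := @Num.sqrt R)).
  by apply: continuous_measurable_fun; exact: sqrt_continuous.
by apply: measurable_funD; exact: measurable_funX.
Qed.

Lemma measurable_scalar_funZ g f : measurable_fun setT g ->
  measurable_scalar_fun f ->
  measurable_scalar_fun (fun x => scalar_of_real (g x) * f x).
Proof.
rewrite /scalar_of_real /measurable_scalar_fun; move: f; case: (K) => /= f mg.
  by move=> mf; exact: measurable_funM.
move=> [mRe mIm]; split.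
  rewrite (_ : (fun _ => _) = g \* (fun x => complex.Re (f x))).
    exact: measurable_funM.
  by apply/funext => x /=; case: (f x) => a b /=; rewrite mul0r subr0.
rewrite (_ : (fun _ => _) = g \* (fun x => complex.Im (f x))).
  exact: measurable_funM.
by apply/funext => x /=; case: (f x) => a b /=; rewrite mul0r addr0.
Qed.

End scalars.

(** * Functions dominated by sums of blocks *)

Definition block_exponent (R : realType) (n : nat) (p s alpha : R) : R :=
  - (alpha / (p * n%:R)) - p^-1 + s^-1.

Lemma block_exponent_le0 (R : realType) (n : nat) (p s alpha : R) :
  (0 < n)%N -> 0 < p -> 0 < s -> - (n%:R * (1 - p / s)) <= alpha ->
  block_exponent n p s alpha <= 0.
Proof.
move=> n0 p0 s0 ha; have n0' : 0 < n%:R :> R by rewrite ltr0n.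
rewrite /block_exponent.
have : - (n%:R * (1 - p / s)) / (p * n%:R) <= alpha / (p * n%:R).
  by rewrite ler_pM2r// invr_gt0 mulr_gt0.
have -> : - (n%:R * (1 - p / s)) / (p * n%:R) = s^-1 - p^-1.
  by field; rewrite !gt_eqF.
lra.
Qed.

Lemma block_exponent_gt (R : realType) (n : nat) (p s alpha : R) :
  (0 < n)%N -> 0 < p -> alpha < n%:R * (p - 1) -> s^-1 - 1 < block_exponent n p s alpha.
Proof.
move=> n0 p0 ha; have n0' : 0 < n%:R :> R by rewrite ltr0n.
rewrite /block_exponent.
have : alpha / (p * n%:R) < n%:R * (p - 1) / (p * n%:R).
  by rewrite ltr_pM2r// invr_gt0 mulr_gt0.
have -> : n%:R * (p - 1) / (p * n%:R) = 1 - p^-1.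
  by field; rewrite !gt_eqF.
lra.
Qed.

Section real_blocks.
Context {R : realType} {n : nat}.
Local Notation mu := (@lebesgue_Rn R n).
Implicit Types (x y : Rn R n) (g : Rn R n -> R) (r s e : R).

(** A block with nonnegative real values.  It vanishes everywhere outside its ball,
    so that the pieces cut from a molecule need no exceptional sets. *)
Definition real_block s e g : Prop :=
  [/\ measurable_fun setT g, forall x, 0 <= g x &
      exists y r, [/\ 0 < r, forall x, ~ cball y r x -> g x = 0 &
        (Lnorm mu s%:E (EFin \o g) <= mu (cball y r) `^ e)%E]].

(** The Hoelder inequality on the ball B of the block gives |B|^(e + 1 - 1/s), which
    is at most 1 when |B| <= 1; on A it gives |B|^e |A|^(1 - 1/s), where
    |B|^e <= 1 when |B| >= 1. *)
Lemma real_block_locally_integrable s e (A : set (Rn R n)) : (0 < n)%N ->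
  1 < s -> s^-1 - 1 < e -> e <= 0 -> measurable A -> (mu A < +oo)%E ->
  exists C : R, forall g, real_block s e g ->
    (\int[mu]_(x in A) (g x)%:E <= C%:E)%E.
Proof.
move=> n0 s1 e1 e0 mA muA; set t := 1 - s^-1.
have t0 : 0 <= t by rewrite subr_ge0 invf_le1 ?ltW// (lt_trans _ s1).
have tE : 0 <= e + t by rewrite /t; lra.
have muAE : mu A = (fine (mu A))%:E by rewrite fineK// ge0_fin_numE.
exists (1 + fine (mu A) `^ t) => g [mg g0 [y [r [r0 gB gs]]]].
have [V [V0 muB _ _]] := measure_cballE y n0 r0.
have mB := measurable_cball y r.
have [V1|V1] := leP V 1.
  apply: (@le_trans _ _ (1%:E)%E); last by rewrite lee_fin lerDl powR_ge0.
  apply: (@le_trans _ _ (\int[mu]_(x in cball y r) (g x)%:E)%E).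
    rewrite !integral_Lnorm1_restrict//; apply: ae_le_Lnorm => //.
    - by apply: measurable_funM => //; exact: measurable_indic.
    - by apply: measurable_funM => //; exact: measurable_indic.
    apply: aeW => x /=; rewrite !indicE.
    have [xB|xB] := pselect (cball y r x).
      rewrite (mem_set xB) mulr1 normrM ler_piMr// ger0_norm.
        by case: (_ \in _).
      by case: (_ \in _).
    by rewrite gB// !mul0r.
  rewrite integral_Lnorm1_restrict//.
  apply: (le_trans (Lnorm1_restrict_le _ s1 mg mB)); rewrite -/t.
  apply: (le_trans (lee_wpmul2r _ gs)); first exact: poweR_ge0.
  rewrite /= muB !poweR_EFin -EFinM lee_fin -powRD; last first.
    by rewrite (gt_eqF V0) implybT.
  by rewrite -(powRr0 V) ger_powR// V0.
apply: (@le_trans _ _ (fine (mu A) `^ t)%:E); last by rewrite lee_fin lerDr.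
rewrite integral_Lnorm1_restrict//.
apply: (le_trans (Lnorm1_restrict_le _ s1 mg mA)); rewrite -/t.
rewrite -[leRHS]mul1e -poweR_EFin -muAE; apply: lee_wpmul2r.
  exact: poweR_ge0.
apply: (le_trans gs); rewrite muB poweR_EFin lee_fin -(powRr0 V).
by apply: ler_powR => //; exact: ltW.
Qed.

End real_blocks.

Section domination.
Context {R : realType} {n : nat} {K : scalar_kind}.
Local Notation mu := (@lebesgue_Rn R n).
Variables (p s alpha : R).
Local Notation e := (block_exponent n p s alpha).

Lemma blockE (a : Rn R n -> scalar_field R K) : 1 < s ->
  block p s%:E alpha a <-> measurable_scalar_fun a /\
    exists (y : Rn R n) (r : R), [/\ 0 < r, supported a (cball y r) &
      (normL s%:E a <= mu (cball y r) `^ e)%E].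
Proof.
move=> s1; rewrite /block (_ : fine s%:E^-1%E = s^-1)//.
by rewrite inver gt_eqF// (lt_trans _ s1).
Qed.

Lemma block_sum_scalar_of_real (c : R^nat) : (forall m, 0 <= c m) ->
  block_sum p (fun m => scalar_of_real (c m) : scalar_field R K) =
  (\sum_(0 <= m <oo) (c m `^ Num.min p 1)%:E)%E.
Proof.
move=> c0; apply: eq_eseriesr => m _.
by rewrite modulus_scalar_of_real ger0_norm.
Qed.

(** The function h is distributed over the blocks in proportion to their share
    c_m g_m / G of the dominating sum G.  The decomposition keeps the coefficients
    c_m, and the block conditions survive because |h / G| <= 1. *)
Lemma dominated_block_decomposition (h : Rn R n -> scalar_field R K)
    (c : R^nat) (g : nat -> Rn R n -> R) :
  (0 < n)%N -> 0 < p -> 1 < s -> s^-1 - 1 < e -> e <= 0 ->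
  measurable_scalar_fun h ->
  (forall m, 0 <= c m) -> (forall m, real_block s e (g m)) ->
  (\sum_(0 <= m <oo) (c m `^ Num.min p 1)%:E < +oo)%E ->
  {ae mu, forall x,
    ((modulus (h x))%:E <= \sum_(0 <= m <oo) (c m * g m x)%:E)%E} ->
  exists b, block_decomposition p s%:E alpha (fun m => scalar_of_real (c m)) b h.
Proof.
move=> n0 p0 s1 e1 e0 mh c0 gblock sumc hle.
have mg m : measurable_fun setT (g m) by have [] := gblock m.
have g0 m x : 0 <= g m x by have [_ /(_ x)] := gblock m.
have cg0 m x : (0 <= (c m * g m x)%:E)%E by rewrite lee_fin mulr_ge0.
have G_fin : {ae mu, forall x, (\sum_(0 <= m <oo) (c m * g m x)%:E < +oo)%E}.
  apply: ae_nneseries_lty => //.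
    apply: nneseries_powR_lty sumc => //; last by rewrite ge_min lexx orbT.
    by rewrite lt_min p0/=.
  move=> A mA muA.
  have [C intC] := real_block_locally_integrable n0 s1 e1 e0 mA muA.
  by exists C => m; exact: intC.
(* Where the sum is infinite, G = 0, and so h / G = 0: the new blocks are below
   the old ones there too. *)
pose G x := fine (\sum_(0 <= m <oo) (c m * g m x)%:E)%E.
have G0 x : 0 <= G x by apply: fine_ge0; exact: nneseries_ge0.
have mG : measurable_fun setT G.
  apply: (measurableT_comp (f := fine)); first exact: fine_measurable.
  apply: ge0_emeasurable_sum => // m _.
  by apply/measurable_EFinP/measurable_funM.
have hG : {ae mu, forall x, modulus (h x) <= G x}.
  apply: filterS2 G_fin hle => x Gx.
  by rewrite -lee_fin /G fineK// ge0_fin_numE// nneseries_ge0.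
have mgG m : measurable_fun setT (fun x => g m x / G x).
  apply: measurable_funM => //.
  rewrite (_ : (fun x => (G x)^-1) = (fun x => G x `^ (-1))).
    exact: (measurableT_comp (measurable_powR _)).
  by apply/funext => x; rewrite powR_inv1.
exists (fun m x => scalar_of_real (g m x / G x) * h x); split.
- move=> m; apply/blockE => //; split; first exact: measurable_scalar_funZ.
  have [_ _ [y [r [r0 gB gs]]]] := gblock m.
  exists y, r; split=> //.
    by apply: aeW => x xB; rewrite gB// mul0r scalar_of_real0 mul0r.
  apply: le_trans gs; apply: ae_le_Lnorm => //; first exact: lt_trans s1.
    by apply: measurable_modulus; exact: measurable_scalar_funZ.
  apply: filterS hG => x hGx; rewrite (ger0_norm (modulus_ge0 _)).
  rewrite modulusM modulus_scalar_of_real !ger0_norm ?divr_ge0//.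
  have [->|Gx0] := eqVneq (G x) 0; first by rewrite invr0 mulr0 mul0r.
  have Gx_gt0 : 0 < G x by rewrite lt_neqAle eq_sym Gx0/=.
  by rewrite mulrAC ler_pdivrMr//; exact: ler_wpM2l.
- by rewrite block_sum_scalar_of_real.
- apply: filterS2 G_fin hG => x Gx hGx.
  have seriesE : series (fun m => scalar_of_real (c m) *
        (scalar_of_real (g m x / G x) * h x)) =
      (fun N => scalar_of_real (\sum_(0 <= m < N) c m * g m x) *
        (scalar_of_real (G x)^-1 * h x)).
    apply/funext => N; rewrite /series/=.
    rewrite (big_morph _ (@scalar_of_realD R K) (@scalar_of_real0 R K)).
    rewrite big_distrl/=; apply: eq_bigr => m _.
    by rewrite !scalar_of_realM; ring.
  rewrite seriesE; set w := scalar_of_real (G x)^-1 * h x.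
  have -> : h x = scalar_of_real (G x) * w.
    rewrite mulrA -scalar_of_realM.
    have [Gx0|Gx0] := eqVneq (G x) 0.
      rewrite (@modulus_eq0 R K (h x)) ?mulr0//.
      by apply/eqP; rewrite eq_le modulus_ge0 andbT -Gx0.
    by rewrite divff// scalar_of_real1 mul1r.
  apply: cvgMr_tmp; apply: scalar_of_real_cvg.
  have cvgG : (fun N => (\sum_(0 <= m < N) (c m * g m x)%:E)%E) @ \oo -->
      (G x)%:E.
    rewrite fineK; first exact: is_cvg_nneseries.
    by rewrite ge0_fin_numE// nneseries_ge0.
  have /fine_cvg := cvgG; rewrite /comp/=; apply: cvg_trans.
  by apply: near_eq_cvg; apply: nearW => N /=; rewrite sumEFin.
Qed.

End domination.

(** * Images of blocks are molecules *)

Section molecules.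
Context {R : realType} {n : nat}.
Local Notation mu := (@lebesgue_Rn R n).

Lemma le_powR_comparable (V W c e : R) : 0 < V -> 0 < W -> 0 < c ->
  W <= c * V -> e <= 0 -> V `^ e <= c `^ (- e) * W `^ e.
Proof.
move=> V0 W0 c0 WV e0; rewrite -{1 3}(opprK e) !(powRN _ (- e)).
rewrite ler_pdivlMr ?powR_gt0// mulrC ler_pdivrMr ?powR_gt0//.
rewrite -powRM ?(ltW c0) ?(ltW V0)//.
by apply: ge0_ler_powR; rewrite ?nnegrE ?oppr_ge0 ?mulr_ge0// ?ltW.
Qed.

(** The size of an annular piece: V and W are the measures of the ball of the block
    and of the outer ball of the annulus, and X is the n-th power of the inner
    radius.  The ratio V / W yields the geometric decay. *)
Lemma le_powR_far_piece (V W X a b s e : R) : 0 < V -> 0 < W -> 0 < X ->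
  0 < b -> W <= a * X -> V <= b * W -> 0 <= 1 - s^-1 + e ->
  V `^ (1 - s^-1 + e) * X^-1 * W `^ s^-1 <= a * b `^ (1 - s^-1 + e) * W `^ e.
Proof.
move=> V0 W0 X0 b0 WX VW; set t := 1 - s^-1 + e => t0.
have XW : X^-1 <= a * W^-1 by rewrite ler_pdivlMr// mulrC ler_pdivrMr.
have VWt : V `^ t <= b `^ t * W `^ t.
  rewrite -powRM ?(ltW b0) ?(ltW W0)//.
  by apply: ge0_ler_powR; rewrite ?nnegrE ?mulr_ge0// ?ltW.
have Wdef : W `^ e = W `^ t * W^-1 * W `^ s^-1.
  have W_neq0 r : (r == 0) ==> (W != 0) by rewrite (gt_eqF W0) implybT.
  have eE : e = t + -1 + s^-1 by rewrite /t; ring.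
  by rewrite [in LHS]eE !powRD ?W_neq0// powR_inv1 ?(ltW W0).
rewrite Wdef [leRHS](_ : _ = b `^ t * W `^ t * (a * W^-1) * W `^ s^-1); last by ring.
apply: ler_wpM2r; first exact: powR_ge0.
by apply: ler_pM => //; rewrite ?powR_ge0// invr_ge0 ltW.
Qed.

(** Here u and v stand for |a| and |Ha|, and rho for a power of 2 comparable to the
    radius r of the ball of a.  The constants M and q depend on the dimension, the
    exponents and the bounds C1 and C2 alone, which makes the coefficients common to
    all blocks. *)
Lemma molecule_decomposition (s e C1 C2 : R) : (0 < n)%N -> 1 < s ->
  s^-1 - 1 < e -> e <= 0 -> 0 <= C1 -> 0 <= C2 ->
  exists M q : R, [/\ 0 < M, 0 < q, q < 1 &
  forall (u v : Rn R n -> R) (y : Rn R n) (r rho : R),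
    measurable_fun setT u -> measurable_fun setT v ->
    (forall x, 0 <= u x) -> (forall x, 0 <= v x) ->
    0 < r -> r <= rho -> rho <= 2 * r ->
    {ae mu, forall x, ~ cball y r x -> u x = 0} ->
    (Lnorm mu s%:E (EFin \o u) <= mu (cball y r) `^ e)%E ->
    (Lnorm mu s%:E (EFin \o v) <= C1%:E * Lnorm mu s%:E (EFin \o u))%E ->
    {ae mu, forall x, 2 * rho <= eucl_dist x y ->
      ((v x)%:E <= C2%:E * Lnorm mu 1 (EFin \o u) *
         ((eucl_dist x y ^+ n)^-1)%:E)%E} ->
    exists g : nat -> Rn R n -> R, (forall i, real_block s e (g i)) /\
      forall x, exists i, v x = M * q ^+ i * g i x].
Proof.
move=> n0 s1 e1 e0 C1_ge0 C2_ge0.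
have n0' : 0 < n%:R :> R by rewrite ltr0n.
have s0 : 0 < s by exact: lt_trans s1.
set t := 1 - s^-1 + e; have t0 : 0 < t by rewrite /t; lra.
(* M0 serves the central ball, where W <= (4 n)^n V, and M1 the annuli; the
   summand 1 makes M positive. *)
pose M0 := C1 * ((4 * n%:R) ^+ n) `^ (- e).
pose M1 := C2 * (4 ^+ n * (n%:R ^+ n) `^ t).
pose M := 1 + M0 + M1; pose q := (2^-1 : R) `^ t.
have M0_ge0 : 0 <= M0 by rewrite mulr_ge0// powR_ge0.
have M1_ge0 : 0 <= M1 by rewrite !mulr_ge0// ?exprn_ge0// powR_ge0.
have M_gt0 : 0 < M by rewrite /M; lra.
have q_gt0 : 0 < q by rewrite powR_gt0.
exists M, q; split=> //.
  rewrite [ltRHS](_ : 1 = 1 `^ t); last by rewrite powR1.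
  apply: gt0_ltr_powR => //; rewrite ?nnegrE ?invr_ge0//.
  by rewrite invf_lt1// ltr1n.
move=> u v y r rho mu_ mv u0 v0 r0 r_rho rho_r u_supp u_norm v_norm v_far.
have rho0 : 0 < rho by exact: lt_le_trans r_rho.
have [V [V0 muV V_ge V_le]] := measure_cballE y n0 r0.
pose rad i := rho * 2 ^+ i.+1.
have rad0 i : 0 < rad i by rewrite mulr_gt0// exprn_gt0.
(* These pieces cover the space because the radii are unbounded: a point lies in
   the piece of the least dyadic ball that contains it. *)
pose piece i := if i is j.+1 then cball y (rad i) `\` cball y (rad j)
                else cball y (rad 0%N).
have mpiece i : measurable (piece i).
  by case: i => [|i]; [|apply: measurableD]; exact: measurable_cball.
have mind i : measurable_fun setT (\1_(cball y (rad i)) : Rn R n -> R).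
  by apply: measurable_indic; exact: measurable_cball.
have piece_cball i : piece i `<=` cball y (rad i) by case: i => // i x [].
have mvp i : measurable_fun setT (v \* \1_(piece i)).
  by apply: measurable_funM => //; exact: measurable_indic.
have piece_norm i : (Lnorm mu s%:E (EFin \o (v \* \1_(piece i))%R) <=
    (M * q ^+ i)%:E * mu (cball y (rad i)) `^ e)%E.
  have [W [W0 muW W_ge W_le]] := measure_cballE y n0 (rad0 i).
  rewrite muW poweR_EFin -EFinM.
  case: i muW W_ge W_le => [|i] muW W_ge W_le.
    (* central ball: the L^s bound on v *)
    have WV : W <= (4 * n%:R) ^+ n * V.
      apply: (le_trans W_le).
      apply: (@le_trans _ _ ((4 * n%:R) ^+ n * (2 * (r / n%:R)) ^+ n)).
        rewrite -exprMn; apply: lerXn2r; rewrite ?nnegrE.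
        - by rewrite mulr_ge0// ltW.
        - by rewrite !mulr_ge0// ?invr_ge0 ltW.
        rewrite (_ : 4 * n%:R * _ = 8 * r); last by field; rewrite gt_eqF.
        by rewrite /rad; lra.
      by apply: ler_wpM2l => //; rewrite exprn_ge0// mulr_ge0// ltW.
    apply: (@le_trans _ _ (Lnorm mu s%:E (EFin \o v))).
      apply: ae_le_Lnorm => //; apply: aeW => x /=.
      rewrite normrM ler_piMr// indicE.
      by case: (_ \in _); rewrite ?normr1 ?normr0.
    apply: (le_trans v_norm).
    apply: (le_trans (lee_wpmul2l _ u_norm)); first by rewrite lee_fin.
    rewrite muV poweR_EFin -EFinM lee_fin expr0 mulr1.
    apply: (@le_trans _ _ (M0 * W `^ e)); last first.
      by apply: ler_wpM2r; [exact: powR_ge0|rewrite /M; lra].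
    rewrite /M0 -mulrA; apply: ler_wpM2l => //.
    by apply: le_powR_comparable => //; rewrite exprn_gt0// mulr_gt0.
  (* annulus: the pointwise decay of v, with the L^1 norm of u at most |B|^t *)
  have u_norm1 : (Lnorm mu 1 (EFin \o u) <= (V `^ t)%:E)%E.
    have mB := measurable_cball y r.
    apply: (@le_trans _ _ (Lnorm mu 1 (EFin \o (u \* \1_(cball y r))%R))).
      apply: ae_le_Lnorm => //.
        by apply: measurable_funM => //; exact: measurable_indic.
      apply: filterS u_supp => x ux /=; rewrite indicE.
      have [xB|xB] := pselect (cball y r x); first by rewrite mem_set// mulr1.
      by rewrite ux// normr0.
    apply: (le_trans (Lnorm1_restrict_le _ s1 mu_ mB)).
    apply: (le_trans (lee_wpmul2r _ u_norm)); first exact: poweR_ge0.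
    rewrite /= muV !poweR_EFin -EFinM -powRD; last first.
      by rewrite (gt_eqF V0) implybT.
    by rewrite lee_fin /t addrC.
  pose X := rad i ^+ n.
  have X0 : 0 < X by rewrite exprn_gt0.
  have D0 : 0 <= C2 * V `^ t * X^-1.
    by rewrite !mulr_ge0// ?powR_ge0// invr_ge0 ltW.
  apply: (@le_trans _ _ (Lnorm mu s%:E (EFin \o
      (fun x => C2 * V `^ t * X^-1 * \1_(cball y (rad i.+1)) x)))).
    apply: ae_le_Lnorm => //.
      by apply: measurable_funM => //; exact: mind.
    apply: filterS v_far => x vx /=; rewrite !indicE.
    have [xp|xp] := pselect (piece i.+1 x); last first.
      by rewrite (memNset xp) mulr0 normr0.
    have [xB xB'] := xp; rewrite (mem_set xp) (mem_set xB) !mulr1 !ger0_norm//.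
    have dist_gt : rad i < eucl_dist x y by rewrite ltNge; apply/negP.
    have dist0 := lt_trans (rad0 i) dist_gt.
    rewrite -lee_fin; apply: (le_trans (vx _)).
      apply: le_trans (ltW dist_gt); rewrite /rad mulrC; apply: ler_wpM2l.
        exact: ltW.
      by rewrite exprS ler_peMr// exprn_ege1// ler1n.
    rewrite [leRHS]EFinM; apply: lee_pmul.
    - by rewrite mule_ge0// ?lee_fin// Lnorm_ge0.
    - by rewrite lee_fin invr_ge0 exprn_ge0// ltW.
    - by rewrite EFinM; apply: (lee_wpmul2l _ u_norm1); rewrite lee_fin.
    rewrite lee_fin lef_pV2 ?posrE ?exprn_gt0//.
    by apply: lerXn2r; rewrite ?nnegrE ltW.
  rewrite LnormZ//.
  rewrite Lnorm_indic//; last exact: measurable_cball.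
  rewrite /= muW poweR_EFin -EFinM lee_fin.
  have radS : rad i.+1 = 2 * rad i by rewrite /rad [2 ^+ i.+2]exprS mulrCA.
  have WX : W <= 4 ^+ n * X.
    by apply: (le_trans W_le); rewrite radS -exprMn mulrA -natrM.
  have VW : V <= n%:R ^+ n * 2^-1 ^+ i.+1 * W.
    apply: (le_trans V_le).
    apply: (@le_trans _ _ (n%:R ^+ n * 2^-1 ^+ i.+1 *
        (2 * (rad i.+1 / n%:R)) ^+ n)); last first.
      by apply: ler_wpM2l => //; rewrite mulr_ge0 ?exprn_ge0 ?invr_ge0.
    apply: (@le_trans _ _ ((n%:R * 2^-1 ^+ i.+1 * (2 * (rad i.+1 / n%:R))) ^+ n)).
      apply: lerXn2r; rewrite ?nnegrE.
      - by rewrite mulr_ge0// ltW.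
      - by apply: mulr_ge0; apply: mulr_ge0;
          rewrite ?exprn_ge0 ?invr_ge0 ?divr_ge0 ?(ltW (rad0 _)).
      rewrite (_ : _ * _ = 4 * (2^-1 ^+ i.+1 * 2 ^+ i.+1) * rho); last first.
        by rewrite /rad [2 ^+ i.+2]exprS; field; rewrite gt_eqF.
      by rewrite -exprMn mulVf// expr1n; lra.
    rewrite exprMn; apply: ler_wpM2r.
      by rewrite exprn_ge0// mulr_ge0// divr_ge0// ltW.
    rewrite exprMn.
    apply: ler_wpM2l; first exact/exprn_ge0/ltW.
    rewrite ler_iXnr// ?exprn_ge0 ?invr_ge0//.
    by rewrite exprn_ile1 ?invr_ge0// invf_le1// ler1n.
  have b0 : 0 < n%:R ^+ n * 2^-1 ^+ i.+1 :> R.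
    by rewrite mulr_gt0 ?exprn_gt0// invr_gt0.
  have := le_powR_far_piece V0 W0 X0 b0 WX VW (ltW t0).
  rewrite -/t powRM ?exprn_ge0 ?invr_ge0 ?(ltW n0')//.
  have -> : (2^-1 ^+ i.+1 : R) `^ t = q ^+ i.+1.
    by rewrite -(@powR_mulrn R 2^-1) ?invr_ge0// powRAC powR_mulrn// powR_ge0.
  move=> /(ler_wpM2l C2_ge0); rewrite !mulrA => /le_trans; apply.
  apply: ler_wpM2r; first exact: powR_ge0.
  apply: ler_wpM2r; first by rewrite exprn_ge0// ltW.
  by rewrite -mulrA -/M1 /M; lra.
exists (fun i x => (M * q ^+ i)^-1 * (v \* \1_(piece i)) x); split=> [i|x].
  have Mq0 : 0 < M * q ^+ i by rewrite mulr_gt0// exprn_gt0.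
  split.
  - exact: measurable_funM.
  - by move=> x; rewrite /= indicE !mulr_ge0// invr_ge0 ltW.
  exists y, (rad i); split=> //.
    by move=> x xB; rewrite /= indicE memNset ?mulr0// => /piece_cball.
  rewrite LnormZ ?invr_ge0 ?(ltW Mq0)//.
  by rewrite lee_pdivrMl.
suff [i xi] : exists i, piece i x.
  exists i; rewrite /= indicE mem_set// mulr1 mulVKf//.
  by rewrite gt_eqF// mulr_gt0// exprn_gt0.
have ex_rad : exists i, eucl_dist x y <= rad i.
  exists (Num.truncn (eucl_dist x y / rho)); rewrite /rad mulrC -ler_pdivrMr//.
  apply/ltW; apply: (lt_le_trans (truncnS_gt _)).
  by rewrite -natrX ler_nat ltnW// ltn_expl.
case: (ex_minnP ex_rad) => -[|i] xi imin; first by exists 0%N.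
exists i.+1; split=> //= xi'; have := imin i xi'.
by rewrite ltnn.
Qed.

End molecules.

(** * Boundedness on the block space *)

(** The decay condition on the operator is stated on balls of radius 2^k, while a
    block lives on a ball of arbitrary radius. *)
Lemma dyadic_bracket (R : realType) (r : R) : 0 < r ->
  exists k : int, r <= 2 ^ k /\ 2 ^ k <= 2 * r.
Proof.
move=> r0; pose l := ln r / ln 2; exists (Num.ceil l).
have ln2 : 0 < ln 2 :> R by rewrite ln_gt0// ltr1n.
have rE : r = 2 `^ l.
  rewrite /powR ifF; last by rewrite gt_eqF.
  by rewrite /l divfK ?gt_eqF// lnK ?posrE.
rewrite -powR_intmul//; have /andP[lt_ceil ceil_le] := ceil_itv l.
split; first by rewrite [leLHS]rE ler_powR// ler1n.
rewrite [in leRHS]rE -{2}(@powRr1 R 2)// -powRD; last by rewrite pnatr_eq0 implybT.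
apply: ler_powR; first by rewrite ler1n.
by move: lt_ceil; rewrite intrB; lra.
Qed.

Theorem theorem4p2 (R : realType) (n : nat) (K : scalar_kind) (s p alpha : R)
    (H : (Rn R n -> scalar_field R K) -> (Rn R n -> scalar_field R K)) :
  (0 < n)%N ->
  1 < s ->
  0 < p -> p <= s ->
  - (n%:R * (1 - p / s)) <= alpha -> alpha < n%:R * (p - 1) ->
  let dom : set (Rn R n -> scalar_field R K) :=
    [set f | inL s%:E f \/ inBL p s%:E alpha f] in
  (forall f, dom f -> measurable_scalar_fun (H f)) ->
  sublinear_on dom H ->
  bounded_on_L s%:E H ->
  (exists C : R, forall (f : Rn R n -> scalar_field R K) (x0 : Rn R n) (k : int),
    dom f -> supported f (cball x0 (2 ^ k)) ->
    {ae @lebesgue_Rn R n, forall x, 2 ^ (k + 1) <= eucl_dist x x0 ->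
      ((modulus (H f x))%:E <=
       C%:E * normL 1 f * ((eucl_dist x x0 ^+ n)^-1)%:E)%E}) ->
  (forall (lambda : nat -> scalar_field R K) (a : nat -> Rn R n -> scalar_field R K) f,
    inBL p s%:E alpha f ->
    block_decomposition p s%:E alpha lambda a f ->
    {ae @lebesgue_Rn R n, forall x,
      ((modulus (H f x))%:E <=
       \sum_(0 <= j <oo) (modulus (lambda j) * modulus (H (a j) x))%:E)%E}) ->
  exists C' : R, forall f : Rn R n -> scalar_field R K, inBL p s%:E alpha f ->
    inBL p s%:E alpha (H f) /\
    (normBL p s%:E alpha (H f) <= C'%:E * normBL p s%:E alpha f)%E.
Proof.
move=> n0 s1 p0 _ alpha_ge alpha_lt dom mH _ [C1 HLs] [C2 Hfar] Hsum.
have s0 : 0 < s by exact: lt_trans s1.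
set e := block_exponent n p s alpha.
have e_le0 : e <= 0 by exact: block_exponent_le0.
have e_gt : s^-1 - 1 < e by exact: block_exponent_gt.
have [M [q [M0 q0 q1 molecule]]] := @molecule_decomposition R n s e `|C1| `|C2|
  n0 s1 e_gt e_le0 (normr_ge0 _) (normr_ge0 _).
have pieces a : block p s%:E alpha a ->
    exists g : nat -> Rn R n -> R, (forall i, real_block s e (g i)) /\
      forall x, exists i, modulus (H a x) = M * q ^+ i * g i x.
  move=> /(blockE _ _ _ s1)[ma [y [r [r0 a_supp a_norm]]]].
  rewrite /supported in a_supp.
  have [V [V0 muV _ _]] := measure_cballE y n0 r0.
  have aLs : inL s%:E a.
    by split=> //; apply: (le_lt_trans a_norm); rewrite muV poweR_EFin ltry.
  have doma : dom a by left.
  have [k [r_le le_r]] := dyadic_bracket r0.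
  apply: (molecule (fun x => modulus (a x)) _ y r (2 ^ k)) => //.
  - exact: measurable_modulus.
  - by apply: measurable_modulus; exact: mH.
  - by move=> x; exact: modulus_ge0.
  - by move=> x; exact: modulus_ge0.
  - by apply: filterS a_supp => x ax /ax ->; rewrite modulus0.
  - apply: (le_trans (HLs _ aLs)); apply: lee_wpmul2r; first exact: Lnorm_ge0.
    by rewrite lee_fin ler_norm.
  - have a_supp2 : supported a (cball y (2 ^ k)).
      apply: filterS a_supp => x ax xB; apply: ax => xr; apply: xB.
      exact: le_trans r_le.
    apply: filterS (Hfar a y k doma a_supp2) => x Hx.
    rewrite -[X in X * _]expr1z -expfzDr// addrC => /Hx /le_trans; apply.
    apply: lee_wpmul2r; first by rewrite lee_fin invr_ge0 exprn_ge0// sqrtr_ge0.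
    by apply: lee_wpmul2r; [exact: Lnorm_ge0|rewrite lee_fin ler_norm].
have p1_gt0 : 0 < Num.min p 1 by rewrite lt_min p0/=.
set p1 := Num.min p 1 in p1_gt0.
have mu0 i : 0 < M * q ^+ i by rewrite mulr_gt0// exprn_gt0.
have S_lty := nneseries_geometric_lty M0 q0 q1 p1_gt0.
set S := (\sum_(0 <= i <oo) ((M * q ^+ i) `^ p1)%:E)%E in S_lty.
have S0 : (0 <= S)%E by apply: nneseries_ge0 => i _ _; rewrite lee_fin powR_ge0.
have SE : S = (fine S)%:E by rewrite fineK// ge0_fin_numE.
have S_gt0 : 0 < fine S.
  rewrite -lte_fin -SE (@lt_le_trans _ _ ((M * q ^+ 0) `^ p1)%:E)//.
    by rewrite lte_fin powR_gt0.
  apply: (@nneseries_ge_term R (fun i => ((M * q ^+ i) `^ p1)%:E)) => i.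
  by rewrite lee_fin powR_ge0.
have [phi phi_bij] : exists phi, set_bij [set: nat] [set: nat * nat] phi.
  by apply/card_set_bijP; rewrite card_eq_sym; exact: card_nat2.
(* The dominating series is indexed by the pairs (j, i), enumerated by phi. *)
have transfer lambda a f : inBL p s%:E alpha f ->
    block_decomposition p s%:E alpha lambda a f -> exists lambda' b,
    block_decomposition p s%:E alpha lambda' b (H f) /\
    block_sum p lambda' = (S * block_sum p lambda)%E.
  move=> fBL fdec; have [ablock sum_lty _] := fdec.
  have {pieces} /choice[g gP] j := pieces _ (ablock j).
  pose c m := modulus (lambda (phi m).1) * (M * q ^+ (phi m).2).
  have c0 m : 0 <= c m by rewrite mulr_ge0 ?modulus_ge0// ltW.
  have sum_c : (\sum_(0 <= m <oo) (c m `^ p1)%:E = S * block_sum p lambda)%E.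
    rewrite (@nneseries_pair R phi (fun j i =>
      ((modulus (lambda j) * (M * q ^+ i)) `^ p1)%:E))//; last first.
      by move=> j i; rewrite lee_fin powR_ge0.
    rewrite SE /block_sum -nneseriesZl; last first.
      by move=> j _; rewrite lee_fin powR_ge0.
    apply: eq_eseriesr => j _; rewrite muleC -SE -nneseriesZl; last first.
      by move=> i _; rewrite lee_fin powR_ge0.
    by apply: eq_eseriesr => i _; rewrite powRM ?modulus_ge0 ?(ltW (mu0 _))// EFinM.
  have sum_c_lty : (\sum_(0 <= m <oo) (c m `^ p1)%:E < +oo)%E.
    by rewrite sum_c SE; apply: lte_mul_pinfty; rewrite // -SE.
  have gblock m : real_block s e (g (phi m).1 (phi m).2) by have [] := gP (phi m).1.
  have Hf_le : {ae @lebesgue_Rn R n, forall x, ((modulus (H f x))%:E <=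
      \sum_(0 <= m <oo) (c m * g (phi m).1 (phi m).2 x)%:E)%E}.
    apply: filterS (Hsum _ _ _ fBL fdec) => x /le_trans; apply.
    have cg0 j i : (0 <= (modulus (lambda j) * (M * q ^+ i) * g j i x)%:E)%E.
      have [_ /(_ x) g0 _] := (gP j).1 i.
      by rewrite lee_fin mulr_ge0// mulr_ge0 ?modulus_ge0 ?(ltW (mu0 _)).
    rewrite (@nneseries_pair R phi (fun j i =>
      (modulus (lambda j) * (M * q ^+ i) * g j i x)%:E))//.
    apply: lee_nneseries => j _; first by rewrite lee_fin mulr_ge0 ?modulus_ge0.
    (* x lies in one of the pieces of H a_j, whose term alone bounds |H a_j x| *)
    have [i ->] := (gP j).2 x; rewrite mulrA.
    exact: (@nneseries_ge_term R (fun i =>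
      (modulus (lambda j) * (M * q ^+ i) * g j i x)%:E)).
  have [b bdec] := @dominated_block_decomposition R n K p s alpha (H f) c _
    n0 p0 s1 e_gt e_le0 (mH f (or_intror fBL)) c0 gblock sum_c_lty Hf_le.
  exists (fun m => scalar_of_real (c m)), b; split=> //.
  by rewrite block_sum_scalar_of_real.
exists (fine S `^ p1^-1) => f fBL; split.
  split; first exact: (mH f (or_intror fBL)).
  have [_ [lambda [a fdec]]] := fBL.
  by have [lambda' [b [bdec _]]] := transfer _ _ _ fBL fdec; exists lambda', b.
have C'0 : 0 < fine S `^ p1^-1 by rewrite powR_gt0.
rewrite -lee_pdivrMl//; apply: le_ereal_inf_tmp => _ [lambda [a [fdec ->]]].
rewrite lee_pdivrMl//.
have [lambda' [b [bdec sum_b]]] := transfer _ _ _ fBL fdec.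
rewrite -poweR_EFin -SE -poweRM//; last first.
  by apply: nneseries_ge0 => j _ _; rewrite lee_fin powR_ge0.
rewrite -sum_b; apply: ereal_inf_lbound.
by exists lambda', b.
Qed.
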